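(* Let $\mathcal{H}$ be a complex separable Hilbert space, let $K$ be a bounded linear operator on $\mathcal{H}$ with closed range, and let $m\in\mathbb{N}$. For each $i\in[m]=\{1,\dots,m\}$, suppose $\{\phi_{ij}\}_{j=1}^\infty$ is a $K$-frame for $\mathcal{H}$ with bounds $A_i$ and $B_i$. Let $\{e_j\}_{j=1}^\infty$ be the canonical orthonormal basis of $\ell^2(\mathbb{N})$. The following conditions are equivalent. (i) The family $\big\{\{\phi_{ij}\}_{j=1}^\infty : i\in[m]\big\}$ is $K$-woven. (ii) There exists $A>0$ such that for any partition $\sigma=\{\sigma_i\}_{i\in[m]}$ of $\mathbb{N}$ there exists a bounded linear operator $M_\sigma:\ell^2(\mathbb{N})\to\mathcal{H}$ such that $M_\sigma(e_j)=\phi_{ij}$ for all $j\in\sigma_i$ and all $i\in[m]$, and $A\,KK^*\le M_\sigma M_\sigma^*$.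
   Context: A sequence $\{f_k\}_{k=1}^\infty\subset\mathcal{H}$ is a $K$-frame for $\mathcal{H}$ with lower bound $A>0$ and upper bound $B>0$ if $A\|K^*f\|^2\le\sum_{k=1}^\infty|\langle f,f_k\rangle|^2\le B\|f\|^2$ for all $f\in\mathcal{H}$. A partition $\{\sigma_i\}_{i\in[m]}$ of $\mathbb{N}$ consists of pairwise disjoint, possibly empty, sets with union $\mathbb{N}$. The union $\bigcup_{i\in[m]}\{\phi_{ij}\}_{j\in\sigma_i}$ is understood as an indexed family (with multiplicity). A family of $K$-frames $\big\{\{\phi_{ij}\}_{j=1}^\infty : i\in[m]\big\}$ is $K$-woven if there exist universal constants $A,B>0$ such that for every partition $\{\sigma_i\}_{i\in[m]}$ of $\mathbb{N}$, the family $\bigcup_{i\in[m]}\{\phi_{ij}\}_{j\in\sigma_i}$ is a $K$-frame for $\mathcal{H}$ with lower bound $A$ and upper bound $B$. For bounded self-adjoint operators, $S\le T$ means $\langle Sf,f\rangle\le\langle Tf,f\rangle$ for all $f\in\mathcal{H}$. *)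

(* Defs.v *)
From HB Require Import structures.
From mathcomp Require Import all_boot all_order all_algebra complex.
From mathcomp Require Import all_classical all_reals all_analysis.
From mathcomp Require Import ring lra.

Set Implicit Arguments.
Unset Strict Implicit.
Unset Printing Implicit Defensive.

Import Order.TTheory GRing.Theory Num.Theory numFieldNormedType.Exports.
Local Open Scope classical_set_scope.
Local Open Scope ring_scope.
Local Open Scope complex_scope.

(* Norms of normed modules over R[i] take their values in R[i]; rnorm is the
   same norm as an element of R (see rnormE). *)
Definition rnorm (R : realType) (V : normedZmodType R[i]) (x : V) : R :=
  complex.Re `|x|.

Section rnorm_theory.
Context (R : realType) (V : normedZmodType R[i]).
Implicit Types x y : V.

Lemma rnormE x : `|x| = (rnorm x)%:C.
Proof.
by rewrite /rnorm [LHS]complexE (ger0_Im (normr_ge0 x)) /= mulr0 addr0.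
Qed.

Lemma rnorm_ge0 x : 0 <= rnorm x.
Proof. by rewrite -ler0c -rnormE. Qed.

Lemma rnorm0 : rnorm (0 : V) = 0.
Proof. by rewrite /rnorm normr0. Qed.

Lemma rnorm_eq0 x : (rnorm x == 0) = (x == 0).
Proof. by rewrite -[RHS]normr_eq0 rnormE -[LHS](inj_eq (@complexI R)). Qed.

Lemma ler_rnormD x y : rnorm (x + y) <= rnorm x + rnorm y.
Proof. by rewrite -lecR rmorphD /= -!rnormE ler_normD. Qed.

Lemma rnormN x : rnorm (- x) = rnorm x.
Proof. by rewrite /rnorm normrN. Qed.

Lemma rnormB x y : rnorm (x - y) = rnorm (y - x).
Proof. by rewrite /rnorm distrC. Qed.

Lemma ler_rnormB x y : rnorm (x - y) <= rnorm x + rnorm y.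
Proof. by rewrite (le_trans (ler_rnormD _ _)) // rnormN. Qed.
End rnorm_theory.

Section rnorm_complex.
Context (R : realType).
Implicit Types z w : R[i].

Lemma rnormM z w : rnorm (z * w) = rnorm z * rnorm w.
Proof. by apply: complexI; rewrite rmorphM /= -!rnormE normrM. Qed.

Lemma rnorm_conj z : rnorm (Num.conj z) = rnorm z.
Proof. by rewrite /rnorm norm_conjC. Qed.

Lemma rnorm_real (x : R) : rnorm x%:C = `|x|.
Proof. by rewrite /rnorm normc_def /= expr0n addr0 sqrtr_sqr. Qed.

Lemma rnorm_sqr z : rnorm z ^+ 2 = complex.Re z ^+ 2 + complex.Im z ^+ 2.
Proof. by rewrite /rnorm normc_def /= sqr_sqrtr // addr_ge0 ?sqr_ge0. Qed.

Lemma ler_Re z : `|complex.Re z| <= rnorm z.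
Proof.
by rewrite -(@ler_pXn2r _ 2) ?nnegrE ?rnorm_ge0 // rnorm_sqr real_normK ?num_real // lerDl sqr_ge0.
Qed.

Lemma ler_Im z : `|complex.Im z| <= rnorm z.
Proof.
by rewrite -(@ler_pXn2r _ 2) ?nnegrE ?rnorm_ge0 // rnorm_sqr real_normK ?num_real // lerDr sqr_ge0.
Qed.

Lemma rnorm_le_ReIm z : rnorm z <= `|complex.Re z| + `|complex.Im z|.
Proof.
rewrite -(@ler_pXn2r _ 2) ?nnegrE ?rnorm_ge0 ?addr_ge0 // rnorm_sqr sqrrD.
by rewrite !real_normK ?num_real // addrAC lerDl mulrn_wge0 ?mulr_ge0.
Qed.

Lemma ReB z w : complex.Re (z - w) = complex.Re z - complex.Re w.
Proof. by case: z w => ? ? []. Qed.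

Lemma ImB z w : complex.Im (z - w) = complex.Im z - complex.Im w.
Proof. by case: z w => ? ? []. Qed.

Lemma gtc0_real (e : R[i]) : 0 < e -> exists2 e' : R, 0 < e' & e = e'%:C.
Proof.
case: e => a b; rewrite ltcE /= => /andP[/eqP -> a0]; by exists a.
Qed.

Lemma cvg_complex (u : (R[i]^o)^nat) (l : R[i]) :
  (fun n => complex.Re (u n)) @ \oo --> complex.Re l ->
  (fun n => complex.Im (u n)) @ \oo --> complex.Im l ->
  u @ \oo --> (l : R[i]^o).
Proof.
move=> /cvgrPdist_lt cr /cvgrPdist_lt ci.
apply/cvgrPdist_lt => e /gtc0_real[e' e0 ->].
have e2 : 0 < e' / 2 by rewrite divr_gt0.
near=> n.
rewrite (@rnormE _ R[i]) ltcR (le_lt_trans (rnorm_le_ReIm _)) //.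
rewrite ReB ImB [e']splitr ltrD //.
  by near: n; exact: cr.
by near: n; exact: ci.
Unshelve. all: by end_near. Qed.

Lemma cvg_conjC (u : (R[i]^o)^nat) (l : R[i]^o) :
  u @ \oo --> l -> (fun n => Num.conj (u n) : R[i]^o) @ \oo --> (Num.conj l : R[i]^o).
Proof.
move=> /cvgrPdist_lt ul; apply/cvgrPdist_lt => e e0; near=> n.
by rewrite -rmorphB norm_conjC; near: n; exact: ul.
Unshelve. all: by end_near. Qed.
End rnorm_complex.

(* The inner product is linear in its first argument and conjugate-linear in
   the second one. *)
HB.mixin Record isInnerProductSpace (R : realType) H
    & NormedModule R[i] H := {
  inner : {dot H for (@Num.conj R[i])};
  inner_normE : forall x : H, `|x| ^+ 2 = inner x x }.

#[short(type="innerProductType")]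
HB.structure Definition InnerProductSpace (R : realType) :=
  {H of isInnerProductSpace R H & NormedModule R[i] H}.

#[short(type="hilbertType")]
HB.structure Definition Hilbert (R : realType) :=
  {H of InnerProductSpace R H & CompleteNormedModule R[i] H}.

Notation "''[' x , y ]" := (inner x%R y%R) : ring_scope.

Section form_norm.
Context (C : numClosedFieldType) (U : lmodType C) (f : {dot U for (@Num.conj C)}).

Lemma dot_CauchySchwarz (u v : U) : `|f u v| ^+ 2 <= f u u * f v v.
Proof.
have [-> | nz_v] := eqVneq v 0; first by rewrite /= !linear0r normr0 expr0n.
have fv0 : f v v != 0 by rewrite dnorm_eq0.
pose a := f u v / f v v; pose w := u - a *: v.
have ow : f w v = 0 by rewrite /w linearBl /= linearZl_LR /= divfK ?subrr.
have fuu : f u u = f w w + `|a| ^+ 2 * f v v.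
  have {1 2}-> : u = w + a *: v by rewrite subrK.
  have ow' : f w (a *: v) = 0 by rewrite linearZr_LR /= ow mulr0.
  by rewrite (hnormDd ow'); congr (_ + _); exact: dnormZ.
have fuv : f u v = a * f v v by rewrite divfK.
rewrite fuu fuv normrM exprMn (ger0_norm (dnorm_ge0 _ _)).
rewrite mulrDl [f v v ^+ 2]expr2 mulrA lerDr.
by rewrite mulr_ge0.
Qed.

Definition form_norm (u : U) : C := sqrtC (f u u).

Lemma form_normZ (l : C) u : form_norm (l *: u) = `|l| * form_norm u.
Proof.
by rewrite /form_norm dnormZ sqrtCM ?nnegrE ?exprn_ge0 // sqrCK.
Qed.

Lemma form_norm_eq0 u : form_norm u = 0 -> u = 0.
Proof. by move=> /eqP; rewrite sqrt_dnorm_eq0 => /eqP. Qed.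

Lemma form_norm_sqr u : form_norm u ^+ 2 = f u u.
Proof. by rewrite sqrtCK. Qed.
Lemma form_normD u v : form_norm (u + v) <= form_norm u + form_norm v.
Proof.
have n0 w : 0 <= form_norm w by rewrite sqrt_dnorm_ge0.
rewrite -(@ler_pXn2r _ 2) ?nnegrE ?addr_ge0 // sqrrD !form_norm_sqr.
rewrite (_ : f (u + v) (u + v) = f u u + f v v + (f u v + (f u v)^*%R)); last first.
  exact: dnormD.
rewrite [leRHS]addrAC lerD2l; set d := f u v.
have dle : `|d| <= form_norm u * form_norm v.
  rewrite -(@ler_pXn2r _ 2) ?nnegrE ?mulr_ge0 //.
  by rewrite exprMn !form_norm_sqr dot_CauchySchwarz.
have dd : d + d^*%R \is Num.real by rewrite CrealE rmorphD /= conjCK addrC.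
rewrite (le_trans (real_ler_norm dd)) // (le_trans (ler_normD _ _)) //.
by rewrite norm_conjC -mulr2n lerMn2r dle orbT.
Qed.

End form_norm.

HB.factory Record Lmodule_isInnerProductSpace (R : realType) H
    & GRing.Lmodule R[i] H := {
  form : {dot H for (@Num.conj R[i])} }.

HB.builders Context (R : realType) H & Lmodule_isInnerProductSpace R H.

HB.instance Definition _ := Lmodule_isNormed.Build R[i] H
  (form_normD form) (form_normZ form) (@form_norm_eq0 _ _ form).

HB.instance Definition _ := isInnerProductSpace.Build R H
  (form_norm_sqr form).

HB.end.

Definition square_summable (R : realType) (u : nat -> R[i]) : Prop :=
  cvgn (series (fun k => rnorm (u k) ^+ 2)).

Section square_summable_theory.
Context (R : realType).
Implicit Types u v : nat -> R[i].

Lemma square_summableP u :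
  square_summable u <->
  exists M, forall n, \sum_(0 <= k < n) rnorm (u k) ^+ 2 <= M.
Proof.
have nd : {homo series (fun k => rnorm (u k) ^+ 2) : n m / (n <= m)%N >-> n <= m}.
  by apply: nondecreasing_series => n _ _; rewrite sqr_ge0.
split=> [cu|[M uM]].
  by eexists=> n; exact: (nondecreasing_cvgn_le nd cu).
apply: nondecreasing_is_cvgn => //; exists M => _ [n _ <-]; exact: uM.
Qed.

Lemma square_summable0 : square_summable (0 : nat -> R[i]).
Proof.
apply/square_summableP; exists 0 => n.
by rewrite big1 // => k _; rewrite rnorm0 expr0n.
Qed.

Lemma ler_sqr_sum (x y z : R) :
  0 <= x -> 0 <= y -> 0 <= z -> z <= x + y -> z ^+ 2 <= (x ^+ 2 + y ^+ 2) *+ 2.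
Proof.
move=> x0 y0 z0 zxy; apply: (@le_trans _ _ ((x + y) ^+ 2)).
  by rewrite ler_pXn2r ?nnegrE ?addr_ge0.
rewrite -subr_ge0 (_ : _ - _ = (x - y) ^+ 2) ?sqr_ge0 //.
by rewrite sqrrD sqrrB mulr2n; lra.
Qed.

Lemma square_summableD u v :
  square_summable u -> square_summable v -> square_summable (u + v).
Proof.
move=> /square_summableP[M uM] /square_summableP[N vN].
apply/square_summableP; exists ((M + N) *+ 2) => n.
apply: (@le_trans _ _ (\sum_(0 <= k < n) (rnorm (u k) ^+ 2 + rnorm (v k) ^+ 2) *+ 2)).
  apply: ler_sum => k _.
  by apply: ler_sqr_sum; rewrite ?rnorm_ge0 ?ler_rnormD.
by rewrite sumrMnl big_split /= lerMn2r lerD ?orbT.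
Qed.

Lemma square_summableZ (a : R[i]) u :
  square_summable u -> square_summable (a *: u).
Proof.
move=> /square_summableP[M uM].
apply/square_summableP; exists (rnorm a ^+ 2 * M) => n.
under eq_bigr do rewrite rnormM exprMn.
by rewrite -mulr_sumr ler_wpM2l ?sqr_ge0.
Qed.

Definition sqsum := [pred u : nat -> R[i] | `[< square_summable u >]].

Lemma sqsum_submod_closed : submod_closed sqsum.
Proof.
split=> [|a u v].
  by apply/asboolP; exact: square_summable0.
move=> /asboolP su /asboolP sv; apply/asboolP.
by apply: square_summableD => //; exact: square_summableZ.
Qed.
HB.instance Definition _ :=
  GRing.isSubmodClosed.Build R[i] (nat -> R[i]) sqsum sqsum_submod_closed.
End square_summable_theory.

(* Sequences are indexed from 0. *)
Record ell2 (R : realType) := Ell2 {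
  ell2_seq :> nat -> R[i];
  _ : ell2_seq \in @sqsum R }.

Section ell2_lmod.
Context (R : realType).
HB.instance Definition _ := [isSub for @ell2_seq R].
HB.instance Definition _ := [Choice of ell2 R by <:].
HB.instance Definition _ := [SubChoice_isSubLmodule of ell2 R by <:].
End ell2_lmod.

Section ell2_inner.
Context (R : realType).
Implicit Types u v w : ell2 R.

Lemma ell2P u : square_summable u.
Proof. by case: u => u /= /asboolP. Qed.

Lemma ell2_ext u v : (forall k, u k = v k) -> u = v.
Proof. by move=> uv; apply/val_inj/funext. Qed.

Definition ell2_prod u v : (R[i]^o)^nat := fun k => u k * Num.conj (v k).

(* The limit is taken in R[i]^o, which carries the topology of R[i]. *)
Definition ell2_dot u v : R[i] := limn (series (ell2_prod u v)).

Lemma Re_series (x : (R[i]^o)^nat) n :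
  complex.Re (series x n) = series (fun k => complex.Re (x k)) n.
Proof.
rewrite /series /=; elim: n => [|n IH]; first by rewrite !big_geq.
by rewrite !big_nat_recr //= -IH; case: (\sum_(0 <= i < n) _) (x n) => ? ? [].
Qed.

Lemma Im_series (x : (R[i]^o)^nat) n :
  complex.Im (series x n) = series (fun k => complex.Im (x k)) n.
Proof.
rewrite /series /=; elim: n => [|n IH]; first by rewrite !big_geq.
by rewrite !big_nat_recr //= -IH; case: (\sum_(0 <= i < n) _) (x n) => ? ? [].
Qed.

Lemma dominated_series_cvg (x : R^nat) (u v : ell2 R) :
  (forall k, `|x k| <= rnorm (ell2_prod u v k : R[i])) -> cvgn (series x).
Proof.
move=> xle; apply: normed_cvg.
apply: (@series_le_cvg _ _ (fun k => rnorm (u k) ^+ 2 + rnorm (v k) ^+ 2)) => //.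
- by move=> k; exact: normr_ge0.
- by move=> k /=; rewrite addr_ge0 ?sqr_ge0.
- move=> k /=; rewrite (le_trans (xle k)) // rnormM rnorm_conj.
  rewrite -subr_ge0; have := sqr_ge0 (rnorm (u k) - rnorm (v k)).
  have := mulr_ge0 (rnorm_ge0 (u k)) (rnorm_ge0 (v k)).
  by rewrite sqrrB mulr2n; lra.
- rewrite -[X in series X]/((fun k => rnorm (u k) ^+ 2) \+ (fun k => rnorm (v k) ^+ 2)).
  rewrite seriesD; apply: is_cvgD; exact: ell2P.
Qed.

Lemma ell2_dot_cvg u v : series (ell2_prod u v) @ \oo --> (ell2_dot u v : R[i]^o).
Proof.
suff : cvgn (series (ell2_prod u v)) by [].
have cr : cvgn (series (fun k => complex.Re (ell2_prod u v k))).
  by apply: (@dominated_series_cvg _ u v) => k; exact: ler_Re.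
have ci : cvgn (series (fun k => complex.Im (ell2_prod u v k))).
  by apply: (@dominated_series_cvg _ u v) => k; exact: ler_Im.
apply/cvg_ex; eexists.
apply: (@cvg_complex _ _ (Complex (limn (series (fun k => complex.Re (ell2_prod u v k))))
  (limn (series (fun k => complex.Im (ell2_prod u v k)))))) => /=.
- by under eq_fun do rewrite Re_series.
- by under eq_fun do rewrite Im_series.
Qed.

Lemma ell2_dotE u v (l : R[i]^o) : series (ell2_prod u v) @ \oo --> l ->
  ell2_dot u v = l.
Proof. by move=> /cvg_lim; apply; exact: norm_hausdorff. Qed.

Lemma cvg_ext (x y : (R[i]^o)^nat) (l : R[i]^o) :
  x @ \oo --> l -> y =1 x -> y @ \oo --> l.
Proof. by move=> xl /funext ->. Qed.

Lemma ell2_dot_conj u v : ell2_dot u v = Num.conj (ell2_dot v u).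
Proof.
apply: ell2_dotE; apply: (cvg_ext (cvg_conjC (@ell2_dot_cvg v u))) => n.
rewrite /series /= rmorph_sum; apply: eq_bigr => k _.
by rewrite /ell2_prod rmorphM /= conjCK mulrC.
Qed.

Lemma ell2_dotPl w a u v :
  ell2_dot (a *: u + v) w = a * ell2_dot u w + ell2_dot v w.
Proof.
apply: ell2_dotE.
apply: (cvg_ext (cvgD (@cvgZr _ _ _ _ _ a _ _ (@ell2_dot_cvg u w)) (@ell2_dot_cvg v w))) => n.
rewrite -[RHS]/(a * series (ell2_prod u w) n + series (ell2_prod v w) n).
rewrite /series /= mulr_sumr -big_split; apply: eq_bigr => k _ /=.
by rewrite /ell2_prod /= mulrDl mulrA.
Qed.

Lemma ell2_dotDl w u v : ell2_dot (u + v) w = ell2_dot u w + ell2_dot v w.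
Proof. by have := ell2_dotPl w 1 u v; rewrite scale1r mul1r. Qed.

Lemma ell2_dot0l w : ell2_dot 0 w = 0.
Proof.
by have := ell2_dotDl w 0 0; rewrite addr0 => /eqP; rewrite -subr_eq subrr => /eqP <-.
Qed.

Lemma ell2_dotZl w a u : ell2_dot (a *: u) w = a * ell2_dot u w.
Proof. by have := ell2_dotPl w a u 0; rewrite ell2_dot0l !addr0. Qed.

Lemma ell2_dotBl w u v : ell2_dot (u - v) w = ell2_dot u w - ell2_dot v w.
Proof. by rewrite -scaleN1r ell2_dotDl ell2_dotZl mulN1r. Qed.

Lemma ell2_dotBr w u v : ell2_dot w (u - v) = ell2_dot w u - ell2_dot w v.
Proof. by rewrite 3![ell2_dot w _]ell2_dot_conj ell2_dotBl rmorphB. Qed.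

Lemma ell2_dotZr w a u : ell2_dot w (a *: u) = Num.conj a * ell2_dot w u.
Proof. by rewrite 2![ell2_dot w _]ell2_dot_conj ell2_dotZl rmorphM. Qed.

HB.instance Definition _ := isBilinear.Build R[i] (ell2 R) (ell2 R) R[i]
  ( *%R ) (Num.conj \; *%R) ell2_dot ell2_dotBl ell2_dotBr
  (fun w a u => ell2_dotZl w a u) ell2_dotZr.

Lemma ell2_dot_herm u v : ell2_dot u v = (-1) ^+ false * Num.conj (ell2_dot v u).
Proof. by rewrite expr0 mul1r ell2_dot_conj. Qed.

HB.instance Definition _ := isHermitianSesquilinear.Build R[i] (ell2 R) false
  Num.conj ell2_dot ell2_dot_herm.

Lemma ell2_sqr_norm u :
  ell2_dot u u = (limn (series (fun k => rnorm (u k) ^+ 2)))%:C.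
Proof.
apply: ell2_dotE; have := @ell2P u => su.
have E k : ell2_prod u u k = (rnorm (u k) ^+ 2)%:C.
  by rewrite /ell2_prod -normCK rnormE rmorphXn.
apply: cvg_complex => /=.
- under eq_fun do rewrite Re_series.
  have -> : (fun k => complex.Re (ell2_prod u u k)) = (fun k => rnorm (u k) ^+ 2).
    by apply/funext => k; rewrite E.
  exact: ell2P.
- under eq_fun do rewrite Im_series.
  have -> : (fun k => complex.Im (ell2_prod u u k)) = (fun=> 0).
    by apply/funext => k; rewrite E.
  have -> : series (fun=> 0 : R) = (fun=> 0).
    by apply/funext => n; rewrite /series /= big1.
  exact: cvg_cst.
Qed.

Lemma ler_ell2_sum u n :
  \sum_(0 <= k < n) rnorm (u k) ^+ 2 <= limn (series (fun k => rnorm (u k) ^+ 2)).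
Proof.
apply: (@nondecreasing_cvgn_le _ (series (fun k => rnorm (u k) ^+ 2))).
  by apply: nondecreasing_series => k _ _; rewrite sqr_ge0.
exact: ell2P.
Qed.

Lemma ler_ell2_coef u k :
  rnorm (u k) ^+ 2 <= limn (series (fun k => rnorm (u k) ^+ 2)).
Proof.
apply: le_trans (ler_ell2_sum u k.+1).
by rewrite big_nat_recr //= lerDr sumr_ge0 // => i _; rewrite sqr_ge0.
Qed.

Lemma ell2_dot_gt0 u : u != 0 -> 0 < ell2_dot u u.
Proof.
move=> u0; rewrite ell2_sqr_norm ltcR.
have [k uk] : exists k, u k != 0.
  apply: contrapT => /forallNP z; move/eqP: u0; apply; apply: ell2_ext => k.
  by apply/eqP; have /negP := z k; rewrite negbK.
apply: lt_le_trans (ler_ell2_coef u k).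
by rewrite exprn_gt0 // lt_def rnorm_ge0 andbT rnorm_eq0.
Qed.

HB.instance Definition _ := isDotProduct.Build R[i] (ell2 R) ell2_dot ell2_dot_gt0.

HB.instance Definition _ := Lmodule_isInnerProductSpace.Build R (ell2 R) ell2_dot.
End ell2_inner.

Section cauchy_rnorm.
Context (R : realType) (V : normedModType R[i]) (F : set_system V).
Context (FF : ProperFilter F).

Lemma cauchy_rnormP : cauchy F -> forall e : R, 0 < e ->
  exists2 A, F A & forall u v, A u -> A v -> rnorm (u - v) < e.
Proof.
move=> /cauchy_ballP cF e e0; have e0' : 0 < e%:C by rewrite ltcR.
have [[A B] /= [FA FB] AB] := cF _ e0'.
exists (A `&` B); first exact: filterI.
move=> u v [Au _] [_ Bv]; have := AB (u, v) (conj Au Bv).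
by rewrite -ball_normE /= rnormE ltcR.
Qed.

Lemma cauchy_lipschitz (g : V -> R) : cauchy F ->
  (forall u v, `|g u - g v| <= rnorm (u - v)) -> cauchy (g @ F).
Proof.
move=> cF gL; apply/cauchy_ballP => e e0.
have [A FA AB] := cauchy_rnormP cF e0.
exists (g @` A, g @` A).
  by split; apply: (@filterS _ F _ A) => // u Au; exists u.
move=> [_ _] /= [[u Au <-] [v Av <-]].
by rewrite -ball_normE /=; exact: le_lt_trans (gL _ _) (AB _ _ Au Av).
Qed.

Lemma cvg_rnormP (l : V) : (forall e : R, 0 < e -> \forall u \near F, rnorm (l - u) <= e) ->
  F --> l.
Proof.
move=> h; apply/cvgrPdist_le => e /gtc0_real[e' e0 ->].
by apply: filterS (h _ e0) => u; rewrite rnormE lecR.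
Qed.
End cauchy_rnorm.

Section ell2_complete.
Context (R : realType).
Implicit Types u v : ell2 R.

Lemma rnorm_ell2 u : rnorm u ^+ 2 = limn (series (fun k => rnorm (u k) ^+ 2)).
Proof.
apply: complexI; rewrite rmorphXn /= -rnormE inner_normE -ell2_sqr_norm.
by [].
Qed.

Lemma ler_ell2_coord u k : rnorm (u k) <= rnorm u.
Proof.
rewrite -(@ler_pXn2r _ 2) ?nnegrE ?rnorm_ge0 // rnorm_ell2.
exact: ler_ell2_coef.
Qed.

Lemma ell2_complete (F : set_system (ell2 R)) :
  ProperFilter F -> cauchy F -> cvg F.
Proof.
move=> FF cF.
pose re k (u : ell2 R) := complex.Re (u k); pose im k (u : ell2 R) := complex.Im (u k).
have cre k : cvg (re k @ F).
  apply/cauchy_cvgP/cauchy_lipschitz => // u v.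
  by rewrite /re -ReB (le_trans (ler_Re _)) // -[X in rnorm X]/((u - v) k) ler_ell2_coord.
have cim k : cvg (im k @ F).
  apply/cauchy_cvgP/cauchy_lipschitz => // u v.
  by rewrite /im -ImB (le_trans (ler_Im _)) // -[X in rnorm X]/((u - v) k) ler_ell2_coord.
pose l k : R[i] := Complex (lim (re k @ F)) (lim (im k @ F)).
have key e : 0 < e -> exists2 A, F A & forall u, A u ->
    forall n, \sum_(0 <= k < n) rnorm (u k - l k) ^+ 2 <= e ^+ 2.
  move=> e0; have [A FA AB] := cauchy_rnormP FF cF e0.
  exists A => // u Au n.
  have cv : (fun v : ell2 R => \sum_(0 <= k < n) rnorm (u k - v k) ^+ 2) @ F -->
      \sum_(0 <= k < n) rnorm (u k - l k) ^+ 2.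
    elim: n => [|k IH].
      rewrite big_geq //; under eq_fun do rewrite big_geq //.
      exact: cvg_cst.
    rewrite big_nat_recr //=; under eq_fun do rewrite big_nat_recr //=.
    apply: (cvgD IH).
    rewrite rnorm_sqr ReB ImB; under eq_fun do rewrite rnorm_sqr ReB ImB.
    apply: cvgD; rewrite expr2; under eq_fun do rewrite expr2.
      by apply: cvgM; apply: cvgB; (exact: cvg_cst || exact: cre).
    by apply: cvgM; apply: cvgB; (exact: cvg_cst || exact: cim).
  apply: (cvgr_to_le cv); apply: filterS FA => v Av.
  apply: le_trans (ler_ell2_sum (u - v) n) _.
  rewrite -rnorm_ell2 ler_pXn2r ?nnegrE ?rnorm_ge0 ?(ltW e0) //.
  exact/ltW/AB.
have lP : square_summable l.
  have [A FA AP] := key 1 ltr01.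
  have [u Au] := filter_ex FA.
  have su : square_summable (fun k => u k - l k).
    by apply/square_summableP; exists (1 ^+ 2) => n; exact: AP.
  have -> : l = (u : nat -> R[i]) + (-1) *: (fun k => u k - l k).
    apply/funext => k; rewrite -[RHS]/(u k + (-1) * (u k - l k)).
    by rewrite mulN1r opprB addrC subrK.
  by apply: square_summableD; [exact: ell2P|exact: square_summableZ].
have lP' : l \in @sqsum R by apply/asboolP.
pose L := Ell2 lP'.
apply/cvg_ex; exists L; apply: cvg_rnormP => e e0.
have [A FA AP] := key _ e0; apply: filterS FA => u Au.
rewrite rnormB -(@ler_pXn2r _ 2) ?nnegrE ?rnorm_ge0 ?(ltW e0) // rnorm_ell2.
apply: limr_le; first exact: (@ell2P R (u - L)).
by apply: nearW => n; exact: AP.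
Qed.

HB.instance Definition _ := Uniform_isComplete.Build (ell2 R) ell2_complete.

Lemma ell2_basis_subproof (j : nat) :
  (fun k => (k == j)%:R : R[i]) \in @sqsum R.
Proof.
apply/asboolP/square_summableP; exists 1 => n.
elim: n => [|n IH]; first by rewrite big_geq.
have [jn|nj] := leqP n j.
  rewrite big_nat_recr //= big1_seq ?add0r.
    by case: eqP => _; rewrite ?rnorm0 -?[1%:R]/1%:C ?rnorm_real ?expr0n ?normr1 ?expr1n.
  move=> k /andP[_]; rewrite mem_index_iota => /andP[_ kn].
  by rewrite ltn_eqF ?rnorm0 ?expr0n // (leq_trans kn).
by rewrite big_nat_recr //= gtn_eqF // rnorm0 expr0n addr0.
Qed.

Definition ell2_basis (j : nat) : ell2 R := Ell2 (ell2_basis_subproof j).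
End ell2_complete.

Section inner_theory.
Context (R : realType) (H : innerProductType R).
Implicit Types x y z : H.

Lemma innerC x y : '[x, y] = Num.conj '[y, x].
Proof. by rewrite hermC expr0 mul1r. Qed.

Lemma innerDl x y z : '[x + y, z] = '[x, z] + '[y, z].
Proof. by rewrite linearDl. Qed.

Lemma innerZl a x y : '[a *: x, y] = a * '[x, y].
Proof. by rewrite linearZl_LR. Qed.

Lemma innerDr x y z : '[z, x + y] = '[z, x] + '[z, y].
Proof. by rewrite linearDr. Qed.

Lemma innerZr a x y : '[x, a *: y] = Num.conj a * '[x, y].
Proof. by rewrite linearZr_LR. Qed.

Lemma inner_rnorm x : '[x, x] = (rnorm x ^+ 2)%:C.
Proof. by rewrite -inner_normE rnormE rmorphXn. Qed.

Lemma innerBl x y z : '[x - y, z] = '[x, z] - '[y, z].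
Proof. by rewrite linearBl. Qed.

Lemma innerBr x y z : '[z, x - y] = '[z, x] - '[z, y].
Proof. by rewrite linearBr. Qed.

Lemma rnormZ (a : R[i]) x : rnorm (a *: x) = rnorm a * rnorm x.
Proof. by apply: complexI; rewrite rmorphM /= -!rnormE normrZ. Qed.

Lemma parallelogram x y :
  rnorm (x + y) ^+ 2 + rnorm (x - y) ^+ 2 = (rnorm x ^+ 2 + rnorm y ^+ 2) *+ 2.
Proof.
apply: complexI; rewrite !(rmorphD, rmorphMn) /= -!inner_rnorm.
rewrite -scaleN1r !(innerDl, innerDr, innerZl, innerZr) rmorphN rmorph1.
by rewrite ?mulN1r; ring.
Qed.

Lemma rnorm_inner x y : rnorm '[x, y] <= rnorm x * rnorm y.
Proof.
rewrite -(@ler_pXn2r _ 2) ?nnegrE ?mulr_ge0 ?rnorm_ge0 // exprMn -lecR [leRHS]rmorphM /=.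
by rewrite -!inner_rnorm rmorphXn /= -rnormE dot_CauchySchwarz.
Qed.
End inner_theory.

Lemma parallelogram_bound (R : realType) (d u v s t a b : R) :
  u < d + b -> v < d + a -> s + t = (v + u) *+ 2 -> d <= 2^-1 ^+ 2 * s ->
  t <= (a + b) *+ 2.
Proof.
have -> : 2^-1 ^+ 2 = 4^-1 :> R by rewrite expr2 -invfM -natrM.
by rewrite -[(v + u) *+ 2]mulr_natr -[(a + b) *+ 2]mulr_natr; lra.
Qed.

Section riesz.
Context (R : realType) (H : hilbertType R) (f : H -> R[i]).
Context (f_linear : forall a x y, f (a *: x + y) = a * f x + f y).
Context (M : R).
Context (f_bounded : forall x, rnorm (f x) <= M * rnorm x).

Let fD x y : f (x + y) = f x + f y.
Proof. by rewrite -[x in LHS]scale1r f_linear mul1r. Qed.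
Let f0 : f 0 = 0.
Proof. by have /eqP := fD 0 0; rewrite addr0 -subr_eq subrr => /eqP <-. Qed.
Let fZ a x : f (a *: x) = a * f x.
Proof. by rewrite -[a *: x]addr0 f_linear f0 addr0. Qed.
Let fB x y : f (x - y) = f x - f y.
Proof. by rewrite -scaleN1r fD fZ mulN1r. Qed.

Let S := [set x | f x = 1].
Let Q := [set rnorm x ^+ 2 | x in S].

Let riesz_min : (exists a, f a != 0) ->
  exists2 p, f p = 1 & forall x, f x = 1 -> rnorm p <= rnorm x.
Proof.
move=> [a fa].
have Q0 : Q !=set0.
  by exists (rnorm ((f a)^-1 *: a) ^+ 2), ((f a)^-1 *: a) => //=; rewrite /S /= fZ mulVf.
have Qlb : lbound Q 0 by move=> _ [x _ <-]; rewrite sqr_ge0.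
have Qinf : has_inf Q by split => //; exists 0.
pose d := inf Q.
have dle x : f x = 1 -> d <= rnorm x ^+ 2.
  by move=> fx; apply: ge_inf; [exists 0|exists x].
have ex n : exists x, f x = 1 /\ rnorm x ^+ 2 < d + n.+1%:R^-1.
  have n0 : 0 < n.+1%:R^-1 :> R by rewrite invr_gt0.
  have [_ [x fx <-] xd] := inf_adherent n0 Qinf.
  by exists x.
have {ex} [x_ xP] := choice ex.
have xB n m : rnorm (x_ n - x_ m) ^+ 2 <= (n.+1%:R^-1 + m.+1%:R^-1) *+ 2.
  have h : f (2^-1 *: (x_ n + x_ m)) = 1.
    by rewrite fZ fD (xP n).1 (xP m).1 -[1 + 1]/(2%:R) mulVf ?pnatr_eq0.
  have := dle _ h; rewrite rnormZ exprMn.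
  have -> : rnorm (2^-1 : R[i]) = 2^-1.
    by rewrite -[2^-1](_ : (2^-1)%:C = _) ?rnorm_real ?gtr0_norm // fmorphV rmorph_nat.
  have := parallelogram (x_ n) (x_ m); have := (xP n).2; have := (xP m).2.
  exact: parallelogram_bound.
have xc : cauchy (x_ @ \oo).
  apply/cauchy_ballP => _ /gtc0_real[e e0 ->].
  have e4 : 0 < e ^+ 2 / 4 by rewrite divr_gt0 ?exprn_gt0.
  have /cvgrPdist_lt /(_ _ e4) [N _ NP] := @cvg_harmonic R.
  have NP' n : (N <= n)%N -> n.+1%:R^-1 < e ^+ 2 / 4.
    by move=> /NP /=; rewrite sub0r normrN gtr0_norm // invr_gt0.
  have FN : (x_ @ \oo) (x_ @` [set n | (N <= n)%N]).
    by exists N => // n Nn; exists n.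
  exists (x_ @` [set n | (N <= n)%N], x_ @` [set n | (N <= n)%N]); first by split.
  move=> [_ _] /= [[n Nn <-] [m Nm <-]]; rewrite -ball_normE /= rnormE ltcR.
  rewrite -(@ltr_pXn2r _ 2) ?nnegrE ?rnorm_ge0 ?(ltW e0) //.
  apply: le_lt_trans (xB _ _) _.
  have := NP' _ Nn; have := NP' _ Nm; rewrite -[X in _ -> _ -> X < _]mulr_natr.
  by move: (n.+1%:R^-1) (m.+1%:R^-1) => ? ?; lra.
have /cvg_ex[p xp] : cvg (x_ @ \oo) by exact/cauchy_cvgP.
have xp' e : 0 < e -> exists N, forall n, (N <= n)%N -> rnorm (p - x_ n) < e.
  move=> e0; have e0' : 0 < e%:C by rewrite ltcR.
  have /cvgrPdist_lt /(_ _ e0') [N _ NP] := xp.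
  by exists N => n /NP /=; rewrite rnormE ltcR.
exists p.
  apply/eqP; rewrite -subr_eq0 -(@rnorm_eq0 _ R[i]) -[_ == 0]negbK; apply/negP => h.
  have h0 : 0 < rnorm (f p - 1) by rewrite lt_def h rnorm_ge0.
  have M0 : 0 < `|M| + 1 by rewrite ltr_wpDl.
  have [N /(_ _ (leqnn N)) NP] := xp' _ (divr_gt0 h0 M0).
  have := f_bounded (p - x_ N); rewrite fB (xP N).1; apply/negP; rewrite -ltNge.
  rewrite ltr_pdivlMr // in NP; apply: le_lt_trans NP.
  rewrite mulrC ler_wpM2l ?rnorm_ge0 //.
  by rewrite (le_trans (ler_norm M)) // lerDl.
move=> x fx.
rewrite -(@ler_pXn2r _ 2) ?nnegrE ?rnorm_ge0 //; apply: le_trans (dle _ fx).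
rewrite leNgt; apply/negP => pd.
have d0 : 0 <= d by apply: lb_le_inf.
have sp : Num.sqrt d < rnorm p.
  by rewrite -(@ltr_pXn2r _ 2) ?nnegrE ?rnorm_ge0 ?sqrtr_ge0 // sqr_sqrtr.
pose e := (rnorm p - Num.sqrt d) / 2.
have e0 : 0 < e by rewrite divr_gt0 ?subr_gt0.
have [N NP] := xp' _ e0.
have q0 : 0 < e ^+ 2 by rewrite exprn_gt0.
have /cvgrPdist_lt /(_ _ q0) [N' _ NP'] := @cvg_harmonic R.
pose n := maxn N N'.
have h1 := NP n (leq_maxl _ _).
have h2 : n.+1%:R^-1 < e ^+ 2.
  by have := NP' n (leq_maxr _ _); rewrite /= sub0r normrN gtr0_norm // invr_gt0.
have h3 : rnorm (x_ n) <= Num.sqrt d + e.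
  rewrite -(@ler_pXn2r _ 2) ?nnegrE ?rnorm_ge0 ?addr_ge0 ?sqrtr_ge0 ?(ltW e0) //.
  rewrite sqrrD sqr_sqrtr // (le_trans (ltW (xP n).2)) // -addrA lerD2l.
  rewrite (le_trans (ltW h2)) // lerDr mulrn_wge0 // mulr_ge0 ?sqrtr_ge0 // ltW //.
have := ler_rnormD (p - x_ n) (x_ n); rewrite subrK => h4.
have : rnorm p < rnorm p; last by rewrite ltxx.
by rewrite /e in h1 h3; lra.
Qed.

Lemma riesz : exists z, forall x, f x = '[x, z].
Proof.
have [/riesz_min[p fp pmin]|nf] := pselect (exists a, f a != 0); last first.
  exists 0 => x; rewrite linear0r; apply: contrapT => /eqP h.
  by apply: nf; exists x.
have orth w : f w = 0 -> '[w, p] = 0.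
  move=> fw; have [->|w0] := eqVneq w 0; first by rewrite linear0l.
  pose t := '[p, w] / '[w, w].
  have ww : '[w, w] != 0 by rewrite dnorm_eq0.
  have ft : f (p - t *: w) = 1 by rewrite fB fZ fw mulr0 subr0.
  have tw : Num.conj t * '[w, w] = '[w, p].
    by rewrite /t rmorphM fmorphV /= -!innerC divfK.
  have := pmin _ ft.
  rewrite -(@ler_pXn2r _ 2) ?nnegrE ?rnorm_ge0 // -lecR -!inner_rnorm.
  have -> : '[p - t *: w, p - t *: w] = '[p, p] - Num.conj t * '[p, w].
    rewrite innerBl innerZl !innerBr !innerZr.
    rewrite (_ : t * ('[w, p] - Num.conj t * '[w, w]) = 0) ?subr0 //.
    by rewrite tw subrr mulr0.
  have -> : Num.conj t * '[p, w] = `|'[p, w]| ^+ 2 / '[w, w].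
    by rewrite /t rmorphM fmorphV /= -(innerC w w) normCK mulrAC; congr (_ / _); exact: mulrC.
  rewrite lerDl oppr_ge0 pmulr_lle0 ?invr_gt0 ?dnorm_gt0 // => h.
  apply/eqP; rewrite innerC conjC_eq0 -normr_eq0 -sqrf_eq0.
  by rewrite eq_le h exprn_ge0.
have p0 : '[p, p] != 0.
  rewrite dnorm_eq0; apply: contraTneq (oner_neq0 R[i]) => p0.
  by rewrite -fp p0 f0 eqxx.
exists ((Num.conj '[p, p])^-1 *: p) => x.
rewrite innerZr fmorphV /= conjCK.
have /orth : f (x - f x *: p) = 0 by rewrite fB fZ fp mulr1 subrr.
rewrite innerBl innerZl => /eqP; rewrite subr_eq0 => /eqP ->.
by rewrite mulrCA mulVf ?mulr1.
Qed.
End riesz.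

Definition bounded_operator (R : realType) (U V : normedModType R[i])
    (T : U -> V) : Prop :=
  exists M : R, forall x, rnorm (T x) <= M * rnorm x.

(* adjoint T y is a vector z with <T x, y> = <x, z> for all x; for T linear and
   bounded it exists by the Riesz representation theorem (adjointP) and is
   unique (adjoint_unique). The value 0 is only taken when no such z exists. *)
Definition adjoint (R : realType) (U V : hilbertType R) (T : U -> V) (y : V) : U :=
  xget 0 [set z | forall x, '[T x, y] = '[x, z]].

Lemma adjointP (R : realType) (U V : hilbertType R) (T : {linear U -> V}) :
  bounded_operator T -> forall x y, '[T x, y] = '[x, adjoint T y].
Proof.
move=> [M TM] x y; rewrite /adjoint.
case: xgetP => [z _ -> //|h]; exfalso.
have fl (a : R[i]) (u v : U) : '[T (a *: u + v), y] = a * '[T u, y] + '[T v, y].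
  by rewrite linearP innerDl innerZl.
have fb u : rnorm '[T u, y] <= (M * rnorm y) * rnorm u.
  by rewrite (le_trans (rnorm_inner _ _)) // mulrAC ler_wpM2r ?rnorm_ge0.
have [z zP] := riesz fl fb.
by apply: (h z) => u; exact: zP.
Qed.

Lemma adjoint_unique (R : realType) (U V : hilbertType R) (T : {linear U -> V})
    (S : V -> U) : bounded_operator T ->
  (forall x y, '[T x, y] = '[x, S y]) -> S =1 adjoint T.
Proof.
move=> bT h y; apply/eqP; rewrite -subr_eq0.
rewrite -(dnorm_eq0 (inner : {dot U for (@Num.conj R[i])})).
by rewrite innerBr -h -adjointP // subrr.
Qed.

(* The order of R[i] only relates numbers with the same imaginary part, hence on
   self-adjoint operators this is the order of the real numbers <S f, f>. *)
Definition op_le (R : realType) (H : hilbertType R) (S T : H -> H) : Prop :=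
  forall f : H, '[S f, f] <= '[T f, f].

Definition separable (T : topologicalType) : Prop :=
  exists2 D : set T, countable D & dense D.

Definition is_partition (I : choiceType) (T : Type) (sigma : I -> set T) : Prop :=
  trivIset [set: I] sigma /\ \bigcup_(i in [set: I]) sigma i = [set: T].

(* The family (phi k), k in D, as an indexed family. The sum of nonnegative
   extended reals does not depend on an enumeration of D; for D = [set: nat] it
   is the usual series (K_frame_natE). *)
Definition K_frame (R : realType) (H : hilbertType R) (K : H -> H)
    (I : choiceType) (D : set I) (phi : I -> H) (A B : R) : Prop :=
  [/\ 0 < A, 0 < B & forall f : H,
    ((A * rnorm (adjoint K f) ^+ 2)%:E
       <= \esum_(k in D) (rnorm '[f, phi k] ^+ 2)%:E
       <= (B * rnorm f ^+ 2)%:E)%E].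

Lemma K_frame_natE (R : realType) (H : hilbertType R) (K : H -> H)
    (phi : nat -> H) (A B : R) :
  K_frame K [set: nat] phi A B <->
  [/\ 0 < A, 0 < B & forall f : H,
    ((A * rnorm (adjoint K f) ^+ 2)%:E
       <= \sum_(0 <= k <oo) (rnorm '[f, phi k] ^+ 2)%:E
       <= (B * rnorm f ^+ 2)%:E)%E].
Proof.
have E f : (\esum_(k in [set: nat]) (rnorm '[f, phi k] ^+ 2)%:E
    = \sum_(0 <= k <oo) (rnorm '[f, phi k] ^+ 2)%:E)%E.
  by rewrite -nneseries_esumT // => n; rewrite lee_fin sqr_ge0.
by split=> -[A0 B0 h]; split=> // f; have := h f; rewrite E.
Qed.

Definition K_woven (R : realType) (H : hilbertType R) (K : H -> H)
    (m : nat) (phi : 'I_m -> nat -> H) : Prop :=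
  exists A B : R, [/\ 0 < A, 0 < B &
    forall sigma : 'I_m -> set nat, is_partition sigma ->
      K_frame K [set p : 'I_m * nat | sigma p.1 p.2]
        (fun p => phi p.1 p.2) A B].

(* Main.v *)
From HB Require Import structures.
Require Import Defs.
From mathcomp Require Import all_boot all_order all_algebra complex.
From mathcomp Require Import all_classical all_reals all_analysis.

Set Implicit Arguments.
Unset Strict Implicit.
Unset Printing Implicit Defensive.

Import Order.TTheory GRing.Theory Num.Theory numFieldNormedType.Exports.
Local Open Scope classical_set_scope.
Local Open Scope ring_scope.
Local Open Scope complex_scope.


(** A partition of the index set picks one vector psi_j = phi_ij for each j, so
    every woven family is a plain sequence psi, and both conditions speak about
    the Parseval-like quantity sum_j |<f, psi_j>|^2.

    If M : ell2 -> H is bounded and M e_j = psi_j, the j-th coordinate of M^* f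
    is <M^* f, e_j> = <f, psi_j>, so this quantity is |M^* f|^2 = <M M^* f, f>
    (rnorm_adjoint_ell2). As |K^* f|^2 = <K K^* f, f>, the operator inequality
    A K K^* <= M M^* is literally the lower K-frame inequality with bound A
    (op_le_adjoint). The constant A is therefore the same in both conditions.

    What remains is the upper bound. From a woven family one gets M as the
    adjoint of the analysis operator f |-> (<f, psi_j>)_j, which the upper bound
    makes a bounded operator into ell2 (bessel_synthesis). Conversely, whatever
    M is, sum_j |<f, psi_j>|^2 is dominated by the sum over all i and j of
    |<f, phi_ij>|^2, so B_1 + ... + B_m is an upper bound that serves all
    partitions at once. *)

Section adjoint_theory.
Context (R : realType) (U V : hilbertType R).

Lemma inner_separated (x y : U) : (forall z, '[z, x] = '[z, y]) -> x = y.
Proof.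
move=> h; apply/eqP; rewrite -subr_eq0.
by rewrite -(dnorm_eq0 (inner : {dot U for (@Num.conj R[i])})) innerBr h subrr.
Qed.

(** Adjunction is an involution on bounded operators: T is recovered as the
    adjoint of its own adjoint. The bound for M comes from
    |M y|^2 = <T (M y), y> <= C |M y| |y|, divided by |M y|. *)
Lemma adjoint_operator (T : {linear U -> V}) : bounded_operator T ->
  exists M : {linear V -> U}, bounded_operator M /\ adjoint M = T.
Proof.
move=> bT; have adjT := adjointP bT.
have lin : linear (adjoint T).
  move=> a y z; apply: inner_separated => x.
  by rewrite -adjT !innerDr !innerZr !adjT.
pose M : {linear V -> U} :=
  HB.pack (adjoint T) (GRing.isLinear.Build _ _ _ _ (adjoint T) lin).
have bM : bounded_operator M.
  (* The absolute value matters: the constant C of a bound on T may be negative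
     when U is trivial. *)
  have [C TC] := bT; exists `|C| => y; rewrite /M /=; set z := adjoint T y.
  have [->|z0] := eqVneq z 0; first by rewrite rnorm0 mulr_ge0 ?rnorm_ge0.
  have zp : 0 < rnorm z by rewrite lt_def rnorm_eq0 z0 rnorm_ge0.
  rewrite -(ler_pM2l zp) -expr2 mulrCA mulrA.
  apply: (@le_trans _ _ (rnorm '[T z, y])).
    by rewrite adjT -/z inner_rnorm rnorm_real ger0_norm ?sqr_ge0.
  apply: le_trans (rnorm_inner _ _) _.
  rewrite ler_wpM2r ?rnorm_ge0 // (le_trans (TC z)) //.
  by rewrite ler_wpM2r ?rnorm_ge0 ?ler_norm.
exists M; split=> //; apply/funext => x; apply/esym.
apply: (adjoint_unique bM) => y z.
by rewrite innerC [RHS]innerC adjT.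
Qed.

End adjoint_theory.

(** The quadratic form of T T^* is f |-> |T^* f|^2, so the operator order
    between two such products compares norms of adjoints. *)
Lemma op_le_adjoint (R : realType) (U V H : hilbertType R)
    (K : {linear U -> H}) (M : {linear V -> H}) (a : R) :
  bounded_operator K -> bounded_operator M ->
  op_le (fun f => a%:C *: K (adjoint K f)) (fun f => M (adjoint M f)) <->
  forall f, a * rnorm (adjoint K f) ^+ 2 <= rnorm (adjoint M f) ^+ 2.
Proof.
move=> bK bM; rewrite /op_le.
by split=> h f; have := h f;
   rewrite innerZl !adjointP // !inner_rnorm -rmorphM lecR.
Qed.

Section ell2_operators.
Context (R : realType) (H : hilbertType R).

Lemma inner_ell2_basis (u : ell2 R) j : '[u, ell2_basis R j] = u j.
Proof.
rewrite -[LHS]/(ell2_dot u (ell2_basis R j)).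
apply: ell2_dotE; apply: cvg_near_cst; exists j.+1 => // n /= jn.
rewrite /series /= /ell2_prod big_mkord (bigD1 (Ordinal jn)) //= eqxx.
rewrite rmorph1 mulr1 big1 ?addr0 // => k kj.
have /negbTE -> : (k : nat) != j by apply: contra kj => /eqP e; apply/eqP/val_inj.
by rewrite rmorph0 mulr0.
Qed.

Lemma esum_ell2 (u : ell2 R) :
  (\esum_(j in [set: nat]) (rnorm (u j) ^+ 2)%:E = (rnorm u ^+ 2)%:E)%E.
Proof.
rewrite -nneseries_esumT => [|j]; last by rewrite lee_fin sqr_ge0.
rewrite rnorm_ell2 -EFin_lim; last exact: ell2P.
by congr (limn _); apply/funext => n; rewrite /series /= sumEFin.
Qed.

Lemma adjoint_ell2 (M : {linear ell2 R -> H}) (f : H) j : bounded_operator M ->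
  adjoint M f j = '[f, M (ell2_basis R j)].
Proof.
by move=> bM; rewrite -inner_ell2_basis innerC -adjointP // -innerC.
Qed.

Lemma rnorm_adjoint_ell2 (M : {linear ell2 R -> H}) (f : H) :
  bounded_operator M ->
  (\esum_(j in [set: nat]) (rnorm '[f, M (ell2_basis R j)] ^+ 2)%:E
    = (rnorm (adjoint M f) ^+ 2)%:E)%E.
Proof.
by move=> bM; rewrite -esum_ell2; apply: eq_esum => j _; rewrite adjoint_ell2.
Qed.

(** The synthesis operator of a Bessel sequence is built as the adjoint of the
    analysis operator f |-> (<f, psi_j>)_j. This avoids showing that the series
    sum_j u_j psi_j converges: the Bessel bound says directly that the analysis
    operator is defined and bounded, and the Riesz theorem does the rest. *)
Lemma bessel_synthesis (psi : nat -> H) (B : R) :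
  (forall f, \esum_(j in [set: nat]) (rnorm '[f, psi j] ^+ 2)%:E
    <= (B * rnorm f ^+ 2)%:E)%E ->
  exists M : {linear ell2 R -> H},
    bounded_operator M /\ forall j, M (ell2_basis R j) = psi j.
Proof.
move=> psiB.
have sq f : (fun j => '[f, psi j]) \in @sqsum R.
  apply/asboolP/square_summableP; exists (B * rnorm f ^+ 2) => n.
  rewrite -lee_fin -sumEFin; apply: le_trans (psiB f).
  rewrite -nneseries_esumT => [|j]; last by rewrite lee_fin sqr_ge0.
  by apply: nneseries_lim_ge => j _ _; rewrite lee_fin sqr_ge0.
pose coef f : ell2 R := Ell2 (sq f).
have lin : linear coef.
  by move=> a f g; apply: ell2_ext => j; rewrite /= innerDl innerZl.
pose T : {linear H -> ell2 R} :=
  HB.pack coef (GRing.isLinear.Build _ _ _ _ coef lin).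
have bT : bounded_operator T.
  (* B need not be nonnegative when H is trivial. *)
  exists (Num.sqrt `|B|) => f; rewrite /T /=.
  rewrite -(@ler_pXn2r _ 2) ?nnegrE ?rnorm_ge0 ?mulr_ge0 ?sqrtr_ge0 ?rnorm_ge0 //.
  rewrite exprMn sqr_sqrtr // -lee_fin -esum_ell2 (le_trans (psiB f)) //.
  by rewrite lee_fin ler_wpM2r ?sqr_ge0 ?ler_norm.
have [M [bM MT]] := adjoint_operator bT; exists M; split=> // j.
by apply: inner_separated => f; rewrite -adjoint_ell2 // MT.
Qed.

End ell2_operators.

(** A partition indexed by I is the same thing as a map to I, so that a family
    woven along it is an ordinary sequence. *)
Lemma partition_selector (I : choiceType) (T : Type) (sigma : I -> set T) :
  is_partition sigma -> exists s : T -> I, forall i j, sigma i j <-> i = s j.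
Proof.
move=> [tr cov].
have ex j : exists i, sigma i j.
  by have : [set: T] j by []; rewrite -cov => -[i _ ?]; exists i.
have [s sP] := choice ex; exists s => i j; split=> [ij|->//].
by apply: tr => //; exists j; split.
Qed.

Lemma esum_selector (R : realType) (I T : choiceType) (sigma : I -> set T)
    (s : T -> I) (a : I -> T -> \bar R) :
  (forall i j, sigma i j <-> i = s j) ->
  (\esum_(p in [set p : I * T | sigma p.1 p.2]) a p.1 p.2
    = \esum_(j in [set: T]) a (s j) j)%E.
Proof.
move=> sP.
rewrite (@reindex_esum _ _ _ [set: T] _ (fun j => (s j, j))) //; split.
- by move=> j _ /=; apply/sP.
- by move=> j k _ _ [].
- by move=> [i j] /= /sP ->; exists j.
Qed.

Theorem theorem2p4 (R : realType) (H : hilbertType R) (K : {linear H -> H})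
    (m : nat) (phi : 'I_m -> nat -> H) (A B : 'I_m -> R)
    (hH : separable H) (hK : bounded_operator K) (hKclosed : closed (range K))
    (hm : (0 < m)%N)
    (hphi : forall i : 'I_m, K_frame K [set: nat] (phi i) (A i) (B i)) :
  K_woven K phi
  <->
  exists A0 : R, 0 < A0 /\
    forall sigma : 'I_m -> set nat, is_partition sigma ->
      exists M : {linear ell2 R -> H},
        [/\ bounded_operator M,
            forall (i : 'I_m) (j : nat), sigma i j -> M (ell2_basis R j) = phi i j &
            op_le (fun f => A0%:C *: K (adjoint K f))
                  (fun f => M (adjoint M f))].
Proof.
split=> [[A0 [B0 [A0_gt0 B0_gt0 woven]]]|[A0 [A0_gt0 hM]]].
- exists A0; split=> // sigma hsigma.
  have [s sP] := partition_selector hsigma.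
  have [_ _ frame] := woven _ hsigma.
  have [M [bM Mphi]] : exists M : {linear ell2 R -> H},
      bounded_operator M /\ forall j, M (ell2_basis R j) = phi (s j) j.
    apply: (@bessel_synthesis _ _ _ B0) => f.
    rewrite -(esum_selector (fun i j => (rnorm '[f, phi i j] ^+ 2)%:E) sP).
    by have /andP[] := frame f.
  exists M; split=> // [i j /sP ->//|].
  apply/op_le_adjoint => // f; rewrite -lee_fin -rnorm_adjoint_ell2 //.
  under eq_esum do rewrite Mphi.
  rewrite -(esum_selector (fun i j => (rnorm '[f, phi i j] ^+ 2)%:E) sP).
  by have /andP[] := frame f.
- have Bsum_gt0 : 0 < \sum_i B i.
    have [_ B0 _] := hphi (Ordinal hm).
    rewrite (bigD1 (Ordinal hm)) //= ltr_pwDl // sumr_ge0 // => i _.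
    by have [_ /ltW] := hphi i.
  exists A0, (\sum_i B i); split=> // sigma hsigma; split=> // f.
  have [s sP] := partition_selector hsigma.
  have [M [bM Mphi /(op_le_adjoint _ hK bM)/(_ f) lower]] := hM _ hsigma.
  rewrite (esum_selector (fun i j => (rnorm '[f, phi i j] ^+ 2)%:E) sP).
  apply/andP; split.
    rewrite -lee_fin -rnorm_adjoint_ell2 // in lower.
    apply: le_trans lower _; apply: le_esum => j _.
    by rewrite (Mphi (s j) j) //; apply/sP.
  apply: (@le_trans _ _
    (\esum_(j in [set: nat]) \sum_i (rnorm '[f, phi i j] ^+ 2)%:E)%E).
    apply: le_esum => j _; rewrite sumEFin lee_fin (bigD1 (s j)) //= lerDl.
    by apply: sumr_ge0 => i _; exact: sqr_ge0.
  rewrite esum_sum => [|j i _ _]; last by rewrite lee_fin sqr_ge0.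
  rewrite mulr_suml -sumEFin; apply: lee_sum => i _.
  by have [_ _ /(_ f)/andP[]] := hphi i.
Qed.
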